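(* Let $\mathcal K,\mathcal K_0\subseteq\mathbb R^d$ be nonempty bounded convex sets (with $\mathcal K_0\ne\{0\}$) such that $\mathcal K_0\subseteq\mathcal K\subseteq\beta\mathcal K_0$ for some $\beta\ge1$. If $\mathcal K_0$ is centrally symmetric about the origin, i.e. $\mathcal K_0=-\mathcal K_0$, then for all $s\in[d]$ and any given starting point $x^{(1)}\in\mathcal K_0$ (used for both bodies), $$\mathrm{gain}(\mathcal K,s)\ \ge\ \frac1\beta\,\mathrm{gain}(\mathcal K_0,s).$$
   Context: Notation: $[d]=\{1,\dots,d\}$. For a partition $\mathcal B=\{B_1,\dots,B_n\}$ of $[d]$ into $n$ nonempty blocks, $\|x\|_{[\mathcal B]}=\sum_{j=1}^n\|x_{B_j}\|_2$, where $x_{B_j}$ is the restriction of $x$ to the coordinates in $B_j$; the dual norm is $\|g\|^*_{[\mathcal B]}=\max_j\|g_{B_j}\|_2$. The partition is equal-size if block sizes differ by at most $1$. Put $(\gamma_1,p_1)=(1,2)$, $(\gamma_2,p_2)=(\tfrac12,2)$, and $\gamma_n=\frac1{e\ln n}$, $p_n=1+\frac1{\ln n}$ for $n\ge3$. Define $h_{\mathcal B}(x)=\frac1{\gamma_np_n}\sum_{j=1}^n\|x_{B_j}\|_2^{p_n}$ and, for $\rho>0$, $h_{\mathcal B,\rho}(x)=\rho^2h_{\mathcal B}(x/\rho)$. For differentiable $h$, $B_h(x\|y)=h(x)-h(y)-\langle\nabla h(y),x-y\rangle$. For bounded convex $A\subseteq\mathbb R^d$, $\rho_n(A)=\max_{\mathcal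 B}\sup_{x\in A}\|x\|_{[\mathcal B]}$, the maximum over equal-size $n$-partitions. With $\mathcal B$ a uniformly random equal-size $n$-partition and $x^{(1)}\in A$ a fixed starting point (independent of $\mathcal B$), define $D_n(A)=\big(\mathbb E_{\mathcal B}\big[\sup_{z\in A}B_{h_{\mathcal B,\rho_n(A)}}(z\|x^{(1)})\big]\big)^{1/2}$, and $G_n(s)=\sup\{(\mathbb E_{\mathcal B}[(\|c\|^*_{[\mathcal B]})^2])^{1/2}: c\in[-1,1]^d,\ |\mathrm{supp}(c)|\le s\}$. The gain of block norms is $$\mathrm{gain}(A,s)=\frac{\min\{D_1(A)G_1(s),\,D_d(A)G_d(s)\}}{\min_{1\le n\le d}D_n(A)G_n(s)}.$$ *)

(* Defs.v *)
From HB Require Import structures.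
From mathcomp Require Export all_boot all_order all_algebra.
From mathcomp Require Export all_classical all_reals all_analysis.
Export numFieldNormedType.Exports.
Set Implicit Arguments.
Unset Strict Implicit.
Unset Printing Implicit Defensive.
Import Order.TTheory GRing.Theory Num.Theory.
Local Open Scope classical_set_scope.
Local Open Scope ring_scope.

(* The ambient space R^d is 'rV[R]_d over an arbitrary R : realType, with     *)
(* coordinates indexed by 'I_d. All the suprema below are over nonempty       *)
(* bounded subsets of R when A is nonempty and bounded, so real-valued [sup]  *)
(* is the true supremum.                                                      *)

(* Equal-size partitions of the index set into n blocks; finset.partition     *)
(* requires the blocks to be nonempty.                                        *)
Definition equipart (d n : nat) : {set {set {set 'I_d}}} :=
  [set P : {set {set 'I_d}} |
    [&& finset.partition P [set: 'I_d], #|P| == n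
      & [forall B1 in P, forall B2 in P, (#|B1| <= #|B2|.+1)%N]]]%SET.

(* Expectation of F P for P uniformly distributed in [equipart d n]. *)
Definition Epart (R : realType) (d n : nat) (F : {set {set 'I_d}} -> R) : R :=
  (\sum_(P in equipart d n) F P) / #|equipart d n|%:R.

(* ||x_B||_2 *)
Definition restr_norm (R : realType) (d : nat) (B : {set 'I_d})
    (x : 'rV[R]_d) : R :=
  Num.sqrt (\sum_(i in B) x 0 i ^+ 2).

Definition block_norm (R : realType) (d : nat) (P : {set {set 'I_d}})
    (x : 'rV[R]_d) : R :=
  \sum_(B in P) restr_norm B x.

(* Block norms are nonnegative, so starting the maximum at 0 is harmless. *)
Definition dual_block_norm (R : realType) (d : nat) (P : {set {set 'I_d}})
    (g : 'rV[R]_d) : R :=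
  \big[Num.max/0]_(B in P) restr_norm B g.

Definition gam (R : realType) (n : nat) : R :=
  if (n <= 1)%N then 1 else if n == 2%N then 2^-1
  else (expR 1 * ln n%:R)^-1.

Definition pexp (R : realType) (n : nat) : R :=
  if (n <= 2)%N then 2 else 1 + (ln n%:R)^-1.

Definition hblock (R : realType) (d : nat) (P : {set {set 'I_d}})
    (x : 'rV[R]_d) : R :=
  (gam R #|P| * pexp R #|P|)^-1 *
  \sum_(B in P) restr_norm B x `^ pexp R #|P|.

Definition hblock_scaled (R : realType) (d : nat) (P : {set {set 'I_d}})
    (rho : R) (x : 'rV[R]_d) : R :=
  rho ^+ 2 * hblock P (rho^-1 *: x).

Definition inner (R : realType) (d : nat) (u v : 'rV[R]_d) : R :=
  \sum_(i < d) u 0 i * v 0 i.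

Definition gradient (R : realType) (d : nat) (h : 'rV[R]_d -> R)
    (y : 'rV[R]_d) : 'rV[R]_d :=
  \row_(i < d) 'D_(delta_mx 0 i) h y.

Definition bregman (R : realType) (d : nat) (h : 'rV[R]_d -> R)
    (x y : 'rV[R]_d) : R :=
  h x - h y - inner (gradient h y) (x - y).

Definition rho_ (R : realType) (d : nat) (A : set 'rV[R]_d) (n : nat) : R :=
  \big[Num.max/0]_(P in equipart d n) sup [set block_norm P x | x in A].

Definition D_ (R : realType) (d : nat) (x1 : 'rV[R]_d) (A : set 'rV[R]_d)
    (n : nat) : R :=
  Num.sqrt (Epart n (fun P =>
    sup [set bregman (hblock_scaled P (rho_ A n)) z x1 | z in A])).

Definition G_ (R : realType) (d : nat) (s n : nat) : R :=
  sup [set Num.sqrt (Epart n (fun P => dual_block_norm P c ^+ 2))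
      | c in [set c : 'rV[R]_d | (forall i, -1 <= c 0 i <= 1) /\
                                 (#|[set i | c 0%R i != 0%R]%SET| <= s)%N]].

(* The minimum over 1 <= n <= d is seeded with its own n = 1 term. *)
Definition gain (R : realType) (d : nat) (x1 : 'rV[R]_d) (A : set 'rV[R]_d)
    (s : nat) : R :=
  Num.min (D_ x1 A 1 * G_ R d s 1) (D_ x1 A d * G_ R d s d) /
  \big[Num.min/D_ x1 A 1 * G_ R d s 1]_(1 <= n < d.+1)
    (D_ x1 A n * G_ R d s n).

(* Main.v *)
Require Import Defs.
From mathcomp Require Import ring lra.
Import Order.TTheory GRing.Theory Num.Theory.
Local Open Scope classical_set_scope.
Local Open Scope ring_scope.

(** For a partition P with exponent p = p_n, write f(x) for the sum over the
    blocks B of |x_B|^p (powpot below), a p-homogeneous function. Rescaling h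
    only multiplies f by a weight: h_rho = rho^(2-p) f / (gamma p), because
    rho^2 f(x / rho) = rho^(2-p) f(x). Hence the divergence of h_rho is this
    weight times the divergence V(z) = f(z) - f(y) - <grad f(y), z - y> of f
    (bregman_hblock_scaled), and rho enters only through rho^(2-p), which is
    nondecreasing in rho since p <= 2.

    Passing from K0 to a larger K enlarges rho, and it enlarges the set over
    which the nonnegative V is maximised, so D_n(K0) <= D_n(K) (le_D).

    Conversely K lies in beta K0, so rho_n(K) <= beta rho_n(K0), and the weight
    grows by at most beta^(2-p). For the divergence itself, write
    V(z) = f(z) - <g, z> + C where g = grad f(y) and C = V(0) >= 0. Then
    V(beta z) = beta^p f(z) - beta <g, z> + C. As soon as <g, z> <= 0 each of
    the three terms is at most beta^p times the corresponding term of V(z); if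
    <g, z> > 0 the same comparison holds with -z instead of z, as f is even.
    The symmetry of K0 allows this change of sign (powdivZ). In total D_n^2
    grows by at most beta^(2-p) beta^p = beta^2, so D_n(K) <= beta D_n(K0)
    (D_le_scale).

    The factors G_n do not depend on the body. The numerator of the gain thus
    does not decrease from K0 to K and the denominator grows at most by the
    factor beta (le_ratio_bigmin).

    The analytic input is that f is convex with the expected gradient. The
    gradient is a vector of directional derivatives, so it is computed one
    coordinate at a time (gradient_powpot): along an axis the block norm is the
    square root of a quadratic polynomial, which is smooth unless the block of
    y vanishes, and then p > 1 makes the derivative 0. The tangent inequality
    for f (powpot_subgradient) follows blockwise from Cauchy-Schwarz and from
    the tangent inequality of t^p, an instance of Young's inequality. *)

(** * Euclidean norms of restrictions *)

Section RestrNorm.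
Set Implicit Arguments.
Unset Strict Implicit.
Context {R : realType} {d : nat}.
Implicit Types (B : {set 'I_d}) (x y : 'rV[R]_d).

Lemma sumsq_ge0 B x : 0 <= \sum_(i in B) x 0 i ^+ 2.
Proof. by apply: sumr_ge0 => i _; exact: sqr_ge0. Qed.

Lemma restr_norm_ge0 B x : 0 <= restr_norm B x.
Proof. exact: sqrtr_ge0. Qed.

Lemma sqr_restr_norm B x : restr_norm B x ^+ 2 = \sum_(i in B) x 0 i ^+ 2.
Proof. by rewrite sqr_sqrtr// sumsq_ge0. Qed.

Lemma restr_norm_gt0 B x i : i \in B -> x 0 i != 0 -> 0 < restr_norm B x.
Proof.
move=> iB xi0; rewrite sqrtr_gt0 (bigD1 i)//= ltr_wpDr//.
  by apply: sumr_ge0 => j _; exact: sqr_ge0.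
by rewrite lt_neqAle sqr_ge0 andbT eq_sym sqrf_eq0.
Qed.

Lemma restr_normZ B (a : R) x : 0 <= a ->
  restr_norm B (a *: x) = a * restr_norm B x.
Proof.
move=> a0; rewrite /restr_norm -[X in _ = X * _]ger0_norm// -sqrtr_sqr.
rewrite -sqrtrM ?sqr_ge0// mulr_sumr; congr Num.sqrt.
by apply: eq_bigr => i _; rewrite mxE exprMn.
Qed.

Lemma restr_normN B x : restr_norm B (- x) = restr_norm B x.
Proof.
by congr Num.sqrt; apply: eq_bigr => i _; rewrite mxE sqrrN.
Qed.

Lemma le_restr_norm B x (M : R) : (forall i, `|x 0 i| <= M) ->
  restr_norm B x <= Num.sqrt (\sum_(i in B) M ^+ 2).
Proof.
move=> xM; rewrite ler_sqrt; last by apply: sumr_ge0 => i _; exact: sqr_ge0.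
apply: ler_sum => i _; rewrite -real_normK ?num_real//.
by rewrite lerXn2r// nnegrE// (le_trans _ (xM i)).
Qed.

Lemma restr_norm_CauchySchwarz B x y :
  \sum_(i in B) x 0 i * y 0 i <= restr_norm B x * restr_norm B y.
Proof.
have zero (u v : 'rV[R]_d) : restr_norm B u = 0 ->
    \sum_(i in B) u 0 i * v 0 i = 0.
  move=> u0; apply: big1 => i iB; have [->|ui] := eqVneq (u 0 i) 0.
    by rewrite mul0r.
  by have := restr_norm_gt0 iB ui; rewrite u0 ltxx.
have [|xy0] := eqVneq (restr_norm B x * restr_norm B y) 0.
  move/eqP; rewrite mulf_eq0 => /orP[] /eqP u0; first by rewrite u0 mul0r zero.
  by rewrite u0 mulr0; under eq_bigr do rewrite mulrC; rewrite zero.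
have xygt0 : 0 < restr_norm B x * restr_norm B y.
  by rewrite lt_neqAle eq_sym xy0 mulr_ge0// restr_norm_ge0.
set M := restr_norm B x in xygt0 *; set N := restr_norm B y in xygt0 *.
(* expanding this square gives 2 M N (M N - <x_B, y_B>) >= 0 *)
have : 0 <= \sum_(i in B) (N * x 0 i - M * y 0 i) ^+ 2.
  by apply: sumr_ge0 => i _; exact: sqr_ge0.
have -> : \sum_(i in B) (N * x 0 i - M * y 0 i) ^+ 2 =
    N ^+ 2 * (\sum_(i in B) x 0 i ^+ 2) + M ^+ 2 * (\sum_(i in B) y 0 i ^+ 2)
    - 2 * (M * N) * \sum_(i in B) x 0 i * y 0 i.
  rewrite !mulr_sumr -big_split/= -sumrB; apply: eq_bigr => i _; ring.
rewrite -!sqr_restr_norm -/M -/N => h.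
rewrite -(ler_pM2l xygt0); nra.
Qed.
End RestrNorm.

(** * Powers of the norm along an axis *)

(** The difference quotient has modulus [|h| ^ (p - 1)], and p > 1. *)
Lemma is_derive0_norm_powR {R : realType} (p : R) : 1 < p ->
  is_derive (0 : R) 1 (fun t => `|t| `^ p) 0.
Proof.
move=> p1; have q0 : 0 < p - 1 by rewrite subr_gt0.
suff dq : (fun h : R => h^-1 *: (((fun t : R => `|t| `^ p) \o shift 0) (h *: 1) -
    `|0 : R| `^ p)) @ 0^' --> (0 : R).
  by split; [by apply/cvg_ex; exists 0|apply: cvg_lim => //].
apply/cvgr0Pnorm_lt => e e0; near=> h.
have h0 : h != 0 by near: h; exact: nbhs_dnbhs_neq.
rewrite /= addr0 normr0 powR0 ?gt_eqF ?(lt_trans _ p1)// subr0.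
rewrite /GRing.scale/= mulr1 normrM normfV ger0_norm ?powR_ge0//.
rewrite -(@mulr_powRB1 _ `|h| p)// ?(lt_trans _ p1)//.
rewrite mulKf ?normr_eq0//.
(* the radius that makes |h|^(p-1) smaller than e *)
have -> : e = (e `^ (p - 1)^-1) `^ (p - 1).
  by rewrite -powRrM mulVf ?gt_eqF// powRr1// ltW.
rewrite gt0_ltr_powR// ?nnegrE// ?powR_ge0//.
near: h; apply: dnbhs0_lt; exact: powR_gt0.
Unshelve. all: by end_near. Qed.

(** With [a] the moving coordinate and [S] the squared norm at [t = 0], this is
    the derivative of a power of the norm along a coordinate axis. The
    hypothesis [a ^+ 2 <= S] forces [a = 0] when [S = 0], which is where the
    square root is not differentiable. *)
Lemma is_derive0_sqrt_powR {R : realType} (p a S : R) : 1 < p -> a ^+ 2 <= S ->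
  is_derive (0 : R) 1 (fun t => Num.sqrt (t ^+ 2 + 2 * a * t + S) `^ p)
    (p * Num.sqrt S `^ (p - 2) * a).
Proof.
move=> p1 aS; have [S0|S0] := leP S 0.
  have a0 : a = 0 by apply/eqP; rewrite -sqrf_eq0 eq_le sqr_ge0 (le_trans aS).
  have -> : S = 0 by apply/eqP; rewrite eq_le S0 (le_trans _ aS) ?sqr_ge0.
  have -> : (fun t => Num.sqrt (t ^+ 2 + 2 * a * t + 0) `^ p) =
      (fun t => `|t| `^ p).
    by apply/funext => t; rewrite a0 mulr0 mul0r !addr0 sqrtr_sqr.
  rewrite a0 mulr0.
  exact: is_derive0_norm_powR.
pose q (t : R) := t ^+ 2 + 2 * a * t + S.
have dq : is_derive (0 : R) 1 q (2 * a).
  have -> : q = horner ('X ^+ 2 + (2 * a) *: 'X + S%:P).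
    by apply/funext => t; rewrite /q !hornerE.
  by apply: is_derive_eq; rewrite !poly.derivE !hornerE; ring.
have q0 : q 0 = S by rewrite /q expr0n/= mulr0 !add0r.
have ds : is_derive (q 0) 1 Num.sqrt (2 * Num.sqrt S)^-1.
  by rewrite q0; exact: is_derive1_sqrt.
have dp : is_derive ((Num.sqrt \o q) 0) 1 (@powR R ^~ p) (p * Num.sqrt S `^ (p - 1)).
  by rewrite /= q0; apply: is_derive1_powR; rewrite sqrtr_gt0.
have sS0 : Num.sqrt S != 0 by rewrite gt_eqF// sqrtr_gt0.
have := is_derive1_comp dp (is_derive1_comp ds dq).
rewrite /comp/= -/q; congr is_derive.
have -> : p - 1 = p - 2 + 1 by ring.
rewrite powRD ?sS0 ?implybT// powRr1 ?sqrtr_ge0//; by field.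
Qed.

(** * The potential and its gradient *)

Section PowerPotential.
Set Implicit Arguments.
Unset Strict Implicit.
Context {R : realType} {d : nat}.
Implicit Types (P : {set {set 'I_d}}) (B : {set 'I_d}) (x y z : 'rV[R]_d).

Definition powpot P (p : R) x : R := \sum_(B in P) restr_norm B x `^ p.

(** When a block of [y] vanishes, so do the entries [y 0 i], and the value of
    the power at 0 is immaterial even though [p - 2 <= 0]. *)
Definition powpot_grad P (p : R) y : 'rV[R]_d :=
  \row_i (p * restr_norm (finset.pblock P i) y `^ (p - 2) * y 0 i).

Lemma powpotN P p x : powpot P p (- x) = powpot P p x.
Proof. by apply: eq_bigr => B _; rewrite restr_normN. Qed.

Lemma powpotZ P p (a : R) x : 0 <= a ->
  powpot P p (a *: x) = a `^ p * powpot P p x.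
Proof.
move=> a0; rewrite /powpot mulr_sumr; apply: eq_bigr => B _.
by rewrite restr_normZ// powRM// restr_norm_ge0.
Qed.

Lemma powpot0 P p : p != 0 -> powpot P p 0 = 0.
Proof. by move=> p0; rewrite -(scale0r 0) powpotZ// powR0// mul0r. Qed.

Lemma restr_norm_axis B y i (t : R) :
  restr_norm B (t *: delta_mx 0 i + y) =
  if i \in B then Num.sqrt (t ^+ 2 + 2 * y 0 i * t + \sum_(j in B) y 0 j ^+ 2)
  else restr_norm B y.
Proof.
rewrite /restr_norm; case: ifPn => iB; congr Num.sqrt.
  rewrite (bigD1 i)//= [in RHS](bigD1 i)//= !mxE !eqxx/=.
  rewrite addrA; congr (_ + _); first by ring.
  apply: eq_bigr => j /andP[_ ji].
  by rewrite !mxE eqxx/= (negbTE ji) mulr0 add0r.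
apply: eq_bigr => j jB; rewrite !mxE eqxx/=.
have /negbTE -> : j != i by apply: contraNneq iB => <-.
by rewrite mulr0 add0r.
Qed.

(** Only the block containing [i] varies along the axis [i]; the other blocks
    contribute the constant [C]. The factor [k] is the weight that rescaling
    puts in front of the potential. *)
Lemma gradient_powpot P p (k : R) y :
  finset.partition P [set: 'I_d] -> 1 < p ->
  gradient (fun x => k * powpot P p x) y = k *: powpot_grad P p y.
Proof.
move=> Ppart p1; apply/rowP => i; rewrite !mxE.
have /and3P[/eqP covP tiP _] := Ppart.
have icov : i \in finset.cover P by rewrite covP inE.
have BP : finset.pblock P i \in P by rewrite finset.pblock_mem.
have iB : i \in finset.pblock P i by rewrite finset.mem_pblock.
set B := finset.pblock P i in BP iB *.
pose C := \sum_(B' in P | B' != B) restr_norm B' y `^ p.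
pose g (t : R) := k * (C +
  Num.sqrt (t ^+ 2 + 2 * y 0 i * t + \sum_(j in B) y 0 j ^+ 2) `^ p).
have powE t : k * powpot P p (t *: delta_mx 0 i + y) = g t.
  congr (k * _); rewrite /powpot (bigD1 B)//= addrC restr_norm_axis iB.
  congr (_ + _); apply: eq_bigr => B' /andP[B'P B'B].
  rewrite restr_norm_axis; case: ifPn => // iB'.
  by rewrite -(finset.def_pblock tiP B'P iB') eqxx in B'B.
have fy : k * powpot P p y = g 0 by rewrite -powE scale0r add0r.
(* a directional derivative is the derivative at 0 along the line *)
have -> : 'D_(delta_mx 0 i) (fun x => k * powpot P p x) y = 'D_1 g 0.
  rewrite /derive; congr (lim (_ @ 0^')); apply/funext => h /=.
  by rewrite powE fy /GRing.scale/= mulr1 addr0.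
have dg : is_derive (0 : R) 1 (fun t =>
    Num.sqrt (t ^+ 2 + 2 * y 0 i * t + \sum_(j in B) y 0 j ^+ 2) `^ p)
    (p * restr_norm B y `^ (p - 2) * y 0 i).
  apply: is_derive0_sqrt_powR => //.
  by rewrite (bigD1 i)//= lerDl; apply: sumr_ge0 => j _; exact: sqr_ge0.
have := is_deriveZ k (is_deriveD (is_derive_cst C (0 : R) 1) dg).
by rewrite add0r => -[_]; apply: etrans.
Qed.

Lemma innerZ (g z : 'rV[R]_d) (a : R) : inner g (a *: z) = a * inner g z.
Proof. by rewrite /inner mulr_sumr; apply: eq_bigr => i _; rewrite mxE mulrCA. Qed.

Lemma innerZl (g z : 'rV[R]_d) (a : R) : inner (a *: g) z = a * inner g z.
Proof. by rewrite /inner mulr_sumr; apply: eq_bigr => i _; rewrite mxE mulrA. Qed.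

Lemma innerB (g z y : 'rV[R]_d) : inner g (z - y) = inner g z - inner g y.
Proof. by rewrite /inner -sumrB; apply: eq_bigr => i _; rewrite !mxE mulrBr. Qed.

(** The tangent line of [t ^ p] at [N] lies below its graph: this is Young's
    inequality for [M * N ^ (p - 1)] with exponents [p] and [p / (p - 1)]. *)
Lemma powR_tangent (p M N : R) : 1 < p -> 0 <= M -> 0 <= N ->
  p * N `^ (p - 1) * (M - N) <= M `^ p - N `^ p.
Proof.
move=> p1 M0 N0; have p0 : 0 < p by exact: lt_trans p1.
have q0 : 0 < p - 1 by rewrite subr_gt0.
have := @conjugate_powR _ M (N `^ (p - 1)) p (p / (p - 1)) M0 (powR_ge0 _ _) p0.
rewrite divr_gt0// => /(_ isT).
have -> : p^-1 + (p / (p - 1))^-1 = 1 by field; rewrite !gt_eqF.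
move=> /(_ erefl).
have -> : (N `^ (p - 1)) `^ (p / (p - 1)) = N `^ p.
  by rewrite -powRrM mulrCA divff ?gt_eqF// mulr1.
rewrite -(ler_pM2l p0).
have -> : p * (M `^ p / p + N `^ p / (p / (p - 1))) =
    M `^ p + (p - 1) * N `^ p by field; rewrite !gt_eqF.
rewrite -(mulr_powRB1 N0 p0); nra.
Qed.

(** On each block Cauchy-Schwarz bounds the linear term by
    [p N ^ (p - 1) (M - N)], with N and M the block norms of [y] and [z], and
    the tangent inequality in one variable applies. *)
Lemma powpot_subgradient P p y z :
  finset.partition P [set: 'I_d] -> 1 < p ->
  inner (powpot_grad P p y) (z - y) <= powpot P p z - powpot P p y.
Proof.
move=> Ppart p1; have /and3P[_ tiP _] := Ppart.
have -> : inner (powpot_grad P p y) (z - y) =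
    \sum_(i in [set: 'I_d]%SET) powpot_grad P p y 0 i * (z - y) 0 i.
  by apply: eq_bigl => i; rewrite inE.
rewrite (set_partition_big _ Ppart) -sumrB; apply: ler_sum => B BP.
set N := restr_norm B y; set M := restr_norm B z.
have -> : \sum_(i in B) powpot_grad P p y 0 i * (z - y) 0 i =
    p * N `^ (p - 2) * (\sum_(i in B) y 0 i * z 0 i - N ^+ 2).
  rewrite sqr_restr_norm -sumrB mulr_sumr; apply: eq_bigr => i iB.
  by rewrite !mxE (finset.def_pblock tiP BP iB) -/N; ring.
have N0 : 0 <= N by exact: restr_norm_ge0.
apply: le_trans (powR_tangent p1 (restr_norm_ge0 B z) N0).
have -> : N `^ (p - 1) = N * N `^ (p - 2).
  have -> : p - 2 = p - 1 - 1 by ring.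
  by rewrite mulr_powRB1// subr_gt0.
have := restr_norm_CauchySchwarz B y z; rewrite -/N -/M => CS.
have -> : p * (N * N `^ (p - 2)) * (M - N) = p * N `^ (p - 2) * (N * (M - N)).
  by ring.
apply: ler_wpM2l; last by nra.
by rewrite mulr_ge0 ?powR_ge0// ltW// (lt_trans _ p1).
Qed.

(** The Bregman divergence of [powpot] with base point [y], which comes first
    here because it stays fixed while [z] varies over a body. *)
Definition powdiv P (p : R) y z : R :=
  powpot P p z - powpot P p y - inner (powpot_grad P p y) (z - y).

Lemma powdiv_ge0 P p y z : finset.partition P [set: 'I_d] -> 1 < p ->
  0 <= powdiv P p y z.
Proof. by move=> Ppart p1; rewrite subr_ge0 powpot_subgradient. Qed.

(** Separates the terms that scale with [z] from the constant, which is the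
    divergence at [z = 0]. *)
Lemma powdivE P p y z :
  powdiv P p y z = powpot P p z - inner (powpot_grad P p y) z
    + (inner (powpot_grad P p y) y - powpot P p y).
Proof. by rewrite /powdiv innerB; ring. Qed.

(** The linear term [- <g, z>] is multiplied by [b] where the bound allows
    [b `^ p]; this is harmless when that term is nonnegative, and one of [z] and
    [- z] makes it so. This maximum is what the symmetry of the body controls. *)
Lemma powdivZ P p y z (b : R) :
  finset.partition P [set: 'I_d] -> 1 < p -> 1 <= b ->
  powdiv P p y (b *: z) <=
  b `^ p * Num.max (powdiv P p y z) (powdiv P p y (- z)).
Proof.
move=> Ppart p1 b1; have b0 : 0 <= b by exact: le_trans b1.
have bp : b <= b `^ p by rewrite le1r_powR// ltW.
(* the subgradient inequality at z = 0 *)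
have C0 : 0 <= inner (powpot_grad P p y) y - powpot P p y.
  have := powpot_subgradient y 0 Ppart p1.
  rewrite innerB powpot0 ?gt_eqF ?(lt_trans _ p1)// -(scale0r y) innerZ mul0r.
  lra.
rewrite maxr_pMr ?powR_ge0// !powdivE powpotZ// powpotN innerZ.
rewrite -[- z]scaleN1r innerZ.
move: C0; set C := inner _ y - _; set L := inner _ z; set A := powpot P p z => C0.
rewrite le_max; have [L0|L0] := leP 0 L; apply/orP; [right|left]; nra.
Qed.
End PowerPotential.

(** * Comparison of the two bodies *)

Section Comparison.
Set Implicit Arguments.
Unset Strict Implicit.
Context {R : realType} {d : nat}.
Implicit Types (P : {set {set 'I_d}}) (x y z : 'rV[R]_d) (A K : set 'rV[R]_d).
Implicit Types (n s : nat).

(** It suffices that e <= 3, and [expR (- 1/6) >= 5/6] already gives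
    e <= (6/5)^6 < 3. *)
Lemma ln_ge1 n : (2 < n)%N -> 1 <= ln n%:R :> R.
Proof.
move=> n2; rewrite -[leLHS]expRK ler_ln ?posrE ?expR_gt0 ?ltr0n ?(ltn_trans _ n2)//.
apply: (@le_trans _ _ 3); last by rewrite ler_nat.
have e6 : expR 1 = (expR (- 6^-1) ^+ 6)^-1 :> R.
  by rewrite -expRM_natl mulrN mulfV// expRN invrK.
have l6 : 5 / 6 <= expR (- 6^-1) :> R.
  by apply: le_trans (expR_ge1Dx _); lra.
rewrite e6 -[leRHS]invrK lef_pV2 ?posrE ?invr_gt0 ?exprn_gt0 ?expR_gt0//.
apply: (@le_trans _ _ ((5 / 6) ^+ 6)); first by lra.
by rewrite lerXn2r// nnegrE ?expR_ge0//; lra.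
Qed.

Lemma pexp_gt1 n : 1 < pexp R n.
Proof.
rewrite /pexp; case: leqP => [_|n2]; first by lra.
by rewrite ltrDl invr_gt0 (lt_le_trans _ (ln_ge1 n2)).
Qed.

Lemma pexp_le2 n : pexp R n <= 2.
Proof.
rewrite /pexp; case: leqP => [_|n2]; first by lra.
have h := ln_ge1 n2.
have : (ln n%:R)^-1 <= 1 :> R by rewrite invf_le1// (lt_le_trans _ h).
by lra.
Qed.

Lemma gam_gt0 n : 0 < gam R n.
Proof.
rewrite /gam; case: leqP => [_|n1]; first by lra.
case: eqVneq => [_|n2]; first by lra.
have h := @ln_ge1 n; rewrite invr_gt0 mulr_gt0 ?expR_gt0// (lt_le_trans _ (h _))//.
by rewrite ltn_neqAle eq_sym n2.
Qed.

(** By homogeneity of the potential the scale [rho] only contributes a power. *)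
Lemma bregman_hblock_scaled P (rho : R) z y :
  finset.partition P [set: 'I_d] -> 0 < rho ->
  bregman (hblock_scaled P rho) z y =
  rho `^ (2 - pexp R #|P|) / (gam R #|P| * pexp R #|P|) *
  powdiv P (pexp R #|P|) y z.
Proof.
move=> Ppart rho0; set p := pexp R #|P|; set c := gam R #|P| * p.
have p1 : 1 < p by exact: pexp_gt1.
have -> : hblock_scaled P rho = fun x => rho `^ (2 - p) / c * powpot P p x.
  apply/funext => x; rewrite /hblock_scaled /hblock -/p -/c -/(powpot P p _).
  rewrite powpotZ ?invr_ge0 ?ltW// -[rho^-1]powR_inv1 ?ltW// -powRrM mulN1r.
  have r0 : rho != 0 by rewrite gt_eqF.
  by rewrite powRD ?r0 ?implybT// powR_mulrn ?ltW//; ring.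
by rewrite /bregman gradient_powpot// innerZl /powdiv; ring.
Qed.

Lemma equipartP P n : P \in equipart d n ->
  finset.partition P [set: 'I_d] /\ #|P| = n.
Proof. by rewrite inE => /and3P[? /eqP ? _]. Qed.

Lemma bounded_coords A : bounded_set A ->
  exists M : R, forall x, A x -> forall i, `|x 0 i| <= M.
Proof.
move=> [M0 [_ hM]]; exists (M0 + 1) => x Ax i.
have /= h : `|x| <= M0 + 1 by apply: hM Ax; rewrite ltrDl.
apply: le_trans h; rewrite [leRHS]mx_normrE.
exact: (le_bigmax _ (fun ij : 'I_1 * 'I_d => `|x ij.1 ij.2|) (0, i)).
Qed.

Lemma block_norm_ubound P A : bounded_set A ->
  has_ubound [set block_norm P x | x in A].
Proof.
move=> /bounded_coords[M AM].
exists (\sum_(B in P) Num.sqrt (\sum_(i in B) M ^+ 2)) => _ [x Ax <-].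
by apply: ler_sum => B _; apply: le_restr_norm; exact: AM.
Qed.

Lemma powdiv_ubound P (p : R) y A : 0 <= p -> bounded_set A ->
  exists M, forall z, A z -> powdiv P p y z <= M.
Proof.
move=> p0 /bounded_coords[M AM].
exists (\sum_(B in P) Num.sqrt (\sum_(i in B) M ^+ 2) `^ p +
  \sum_i `|powpot_grad P p y 0 i| * M +
  (inner (powpot_grad P p y) y - powpot P p y)) => z Az.
rewrite powdivE lerD2r; apply: lerD.
  apply: ler_sum => B _; apply: ge0_ler_powR => //; rewrite ?nnegrE ?sqrtr_ge0//.
  by apply: le_restr_norm; exact: AM.
rewrite /inner -sumrN; apply: ler_sum => i _.
rewrite (le_trans (ler_norm _))// normrN normrM ler_wpM2l//; exact: AM.
Qed.

Lemma le_rho A K n : A !=set0 -> A `<=` K -> bounded_set K ->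
  rho_ A n <= rho_ K n.
Proof.
move=> A0 AK Kb; apply: le_bigmax2 => P _.
apply: ge_sup => [|_ [x Ax <-]]; first exact: image_nonempty.
by apply: ub_le_sup; [exact: block_norm_ubound|exists x => //; exact: AK].
Qed.

Lemma le_rho_scale A K n (b : R) : K !=set0 -> 0 <= b ->
  K `<=` [set b *: x | x in A] -> bounded_set A ->
  rho_ K n <= b * rho_ A n.
Proof.
move=> K0 b0 KA Ab; apply: bigmax_le => [|P Pn].
  by rewrite mulr_ge0// bigmax_ge_id.
apply: ge_sup => [|_ [_ /KA [x Ax <-] <-]]; first exact: image_nonempty.
have -> : block_norm P (b *: x) = b * block_norm P x.
  by rewrite /block_norm mulr_sumr; apply: eq_bigr => B _; rewrite restr_normZ.
apply: ler_wpM2l => //; apply: le_trans (le_bigmax_cond _ _ Pn).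
by apply: ub_le_sup; [exact: block_norm_ubound|exists x].
Qed.

(** Some block of [P] meets the support of [x]. Positivity is what turns the
    two rescalings into comparable powers of the scale. *)
Lemma rho_gt0 A n P x : bounded_set A -> A x -> x != 0 ->
  P \in equipart d n -> 0 < rho_ A n.
Proof.
move=> Ab Ax x0 Pn; have [Ppart _] := equipartP Pn.
apply: lt_le_trans (le_bigmax_cond _ _ Pn).
apply: (@lt_le_trans _ _ (block_norm P x)); last first.
  by apply: ub_le_sup; [exact: block_norm_ubound|exists x].
have [i xi0] : exists i, x 0 i != 0.
  apply/existsP; apply: contra_neqT x0; rewrite negb_exists => /forallP x0.
  by apply/rowP => i; rewrite mxE; apply/eqP; rewrite -[_ == _]negbK.
have /and3P[/eqP covP _ _] := Ppart.
have icov : i \in finset.cover P by rewrite covP inE.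
have BP : finset.pblock P i \in P by rewrite finset.pblock_mem.
rewrite /block_norm (bigD1 _ BP)/= ltr_wpDr ?sumr_ge0//.
  by move=> B _; exact: restr_norm_ge0.
by apply: restr_norm_gt0 xi0; rewrite finset.mem_pblock.
Qed.

Lemma ler_Epart n (F G : {set {set 'I_d}} -> R) :
  (forall P, P \in equipart d n -> F P <= G P) -> Epart n F <= Epart n G.
Proof. by move=> FG; rewrite ler_wpM2r ?invr_ge0// ler_sum. Qed.

Lemma EpartZ n (a : R) (F : {set {set 'I_d}} -> R) :
  Epart n (fun P => a * F P) = a * Epart n F.
Proof. by rewrite /Epart -mulr_sumr mulrA. Qed.

Lemma G_ge0 s n : 0 <= G_ R d s n.
Proof.
rewrite /G_; set E := (X in sup X).
have [|/sup_out ->//] := pselect (has_sup E).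
move=> [[e Ee] Eub]; apply: le_trans (ub_le_sup Eub Ee).
by case: Ee => c _ <-; exact: sqrtr_ge0.
Qed.

(** The case of a zero denominator, where the quotient is 0 by convention, is
    harmless: the two denominators vanish together. *)
Lemma le_ratio_bigmin (a0 a : nat -> R) (b : R) m : 1 <= b ->
  (forall n, 0 <= a0 n) -> (forall n, a0 n <= a n) ->
  (forall n, a n <= b * a0 n) ->
  b^-1 * (Num.min (a0 1%N) (a0 m) / \big[Num.min/a0 1%N]_(1 <= n < m.+1) a0 n)
  <= Num.min (a 1%N) (a m) / \big[Num.min/a 1%N]_(1 <= n < m.+1) a n.
Proof.
move=> b1 a0_ge0 a_ge a_le.
have b0 : 0 <= b by exact: le_trans b1.
set num0 := Num.min (a0 1%N) _; set num := Num.min (a 1%N) _.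
set den0 := \big[_/a0 1%N]_(_ <= _ < _) _.
set den := \big[_/a 1%N]_(_ <= _ < _) _.
have num0_ge0 : 0 <= num0 by rewrite le_min !a0_ge0.
have num_le : num0 <= num by rewrite le_min !ge_min !a_ge orbT.
have den0_ge0 : 0 <= den0.
  by rewrite /den0; elim/big_ind: _ => // u v u0 v0; rewrite le_min u0.
have den_ge : den0 <= den.
  rewrite /den0 /den; elim/big_ind2: _ => // u u' v v' uu' vv'.
  by rewrite le_min !ge_min uu' vv' orbT.
have den_le : den <= b * den0.
  rewrite /den0 /den; elim/big_ind2: _ => // u u' v v' uu' vv'.
  by rewrite minr_pMr// le_min !ge_min uu' vv' orbT.
have [den00|den00] := eqVneq den0 0.
  rewrite den00 invr0 !mulr0; apply: divr_ge0.
    exact: le_trans num_le.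
  exact: le_trans den_ge.
have den0_gt0 : 0 < den0 by rewrite lt_neqAle eq_sym den00.
have den_gt0 : 0 < den by exact: lt_le_trans den_ge.
have b_gt0 : 0 < b by exact: lt_le_trans b1.
rewrite mulrCA -invfM; apply: ler_pM => //.
  by rewrite invr_ge0 mulr_ge0.
by rewrite lef_pV2// posrE// mulr_gt0.
Qed.

Section Bodies.
Context (K K0 : set 'rV[R]_d) (beta : R) (x1 : 'rV[R]_d).
Context (K0b : bounded_set K0) (Kb : bounded_set K).
Context (beta1 : 1 <= beta) (K0K : K0 `<=` K).
Context (KK0 : K `<=` [set beta *: x | x in K0]).
Context (K0N : forall x, K0 x -> K0 (- x)).
Context (K0neq0 : exists2 x, K0 x & x != 0).

Let beta0 : 0 <= beta. Proof. exact: le_trans beta1. Qed.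
Let K0ne : K0 !=set0. Proof. by case: K0neq0 => x K0x _; exists x. Qed.
Let Kne : K !=set0. Proof. by case: K0ne => x /K0K; exists x. Qed.

Let bregE A n P z : P \in equipart d n -> 0 < rho_ A n ->
  bregman (hblock_scaled P (rho_ A n)) z x1 =
  rho_ A n `^ (2 - pexp R n) / (gam R n * pexp R n) *
    powdiv P (pexp R n) x1 z.
Proof.
by move=> /equipartP[Ppart Pn] r0; rewrite bregman_hblock_scaled// Pn.
Qed.

Let weight_ge0 n (r : R) : 0 <= r / (gam R n * pexp R n) = (0 <= r).
Proof.
by rewrite pmulr_lge0// invr_gt0 mulr_gt0 ?gam_gt0// (lt_trans _ (pexp_gt1 n)).
Qed.

Let breg_ubound A n P : P \in equipart d n -> 0 < rho_ A n -> bounded_set A ->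
  has_ubound [set bregman (hblock_scaled P (rho_ A n)) z x1 | z in A].
Proof.
move=> Pn r0 Ab.
have [|M AM] := @powdiv_ubound P (pexp R n) x1 A _ Ab.
  by rewrite ltW// (lt_trans _ (pexp_gt1 n)).
exists (rho_ A n `^ (2 - pexp R n) / (gam R n * pexp R n) * M) => _ [z Az <-].
by rewrite bregE// ler_wpM2l ?weight_ge0 ?powR_ge0//; exact: AM.
Qed.

(** Both the weight and the set over which the nonnegative divergence is
    maximised grow with the body. *)
Lemma le_D n : D_ x1 K0 n <= D_ x1 K n.
Proof.
apply: ler_wsqrtr; apply: ler_Epart => P Pn /=; have [Ppart _] := equipartP Pn.
have [x0 K0x0 x0N0] := K0neq0.
have r0 : 0 < rho_ K0 n by exact: (@rho_gt0 K0 n P x0).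
have r : 0 < rho_ K n by exact: (@rho_gt0 K n P x0 Kb (K0K K0x0)).
apply: ge_sup => [|_ [z K0z <-]]; first exact: image_nonempty.
apply: (@le_trans _ _ (bregman (hblock_scaled P (rho_ K n)) z x1)); last first.
  by apply: ub_le_sup; [exact: breg_ubound|exists z => //; exact: K0K].
rewrite !bregE// ler_wpM2r ?powdiv_ge0 ?pexp_gt1// ler_wpM2r//.
  by have := weight_ge0 n 1; rewrite mul1r ler01.
apply: ge0_ler_powR; rewrite ?nnegrE ?subr_ge0 ?pexp_le2 ?(ltW r0) ?(ltW r)//.
exact: le_rho.
Qed.

(** The weight accounts for a factor [beta `^ (2 - p)] and the divergence for
    [beta `^ p]; the product is [beta ^+ 2], whatever the exponent. *)
Lemma D_le_scale n : D_ x1 K n <= beta * D_ x1 K0 n.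
Proof.
rewrite -[beta]ger0_norm// -sqrtr_sqr -sqrtrM ?sqr_ge0//.
apply: ler_wsqrtr; rewrite -EpartZ; apply: ler_Epart => P Pn /=.
have [Ppart _] := equipartP Pn; have [x0 K0x0 x0N0] := K0neq0.
have r0 : 0 < rho_ K0 n by exact: (@rho_gt0 K0 n P x0).
have r : 0 < rho_ K n by exact: (@rho_gt0 K n P x0 Kb (K0K K0x0)).
set S := (X in _ * X).
apply: ge_sup => [|_ [_ /KK0[z K0z <-] <-]]; first exact: image_nonempty.
have leS w : K0 w -> bregman (hblock_scaled P (rho_ K0 n)) w x1 <= S.
  by move=> K0w; apply: ub_le_sup; [exact: breg_ubound|exists w].
rewrite (bregE _ Pn r); clearbody S.
have := leS _ (K0N K0z); rewrite (bregE _ Pn r0).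
have := leS _ K0z; rewrite (bregE _ Pn r0).
set p := pexp R n; set c := (gam R n * p)^-1 => zS NzS.
have p1 : 1 < p by exact: pexp_gt1.
have c0 : 0 <= c by have := weight_ge0 n 1; rewrite mul1r ler01.
have wr : rho_ K n `^ (2 - p) <= beta `^ (2 - p) * rho_ K0 n `^ (2 - p).
  rewrite -powRM// ?(ltW r0)//; apply: ge0_ler_powR;
    rewrite ?nnegrE ?subr_ge0 ?pexp_le2 ?(ltW r) ?mulr_ge0// ?(ltW r0)//.
  exact: le_rho_scale.
have -> : beta ^+ 2 = beta `^ (2 - p) * beta `^ p.
  rewrite -powRD ?subrK ?powR_mulrn//.
  by rewrite gt_eqF ?implybT// (lt_le_trans _ beta1).
apply: (@le_trans _ _ (beta `^ (2 - p) * rho_ K0 n `^ (2 - p) * c *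
   (beta `^ p * Num.max (powdiv P p x1 z) (powdiv P p x1 (- z))))).
  apply: ler_pM; rewrite ?mulr_ge0 ?powR_ge0 ?powdiv_ge0//.
    by rewrite ler_wpM2r.
  exact: powdivZ.
rewrite (_ : _ * (_ * _) = beta `^ (2 - p) * beta `^ p * (rho_ K0 n `^ (2 - p) * c *
   Num.max (powdiv P p x1 z) (powdiv P p x1 (- z)))); last by ring.
rewrite ler_wpM2l ?mulr_ge0 ?powR_ge0// maxr_pMr ?mulr_ge0 ?powR_ge0//.
by rewrite ge_max zS NzS.
Qed.

Lemma le_gain s : beta^-1 * gain x1 K0 s <= gain x1 K s.
Proof.
apply: (@le_ratio_bigmin (fun n => D_ x1 K0 n * G_ R d s n)
  (fun n => D_ x1 K n * G_ R d s n)) => [|n|n|n]; first exact: beta1.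
- by apply: mulr_ge0; [exact: sqrtr_ge0|exact: G_ge0].
- by apply: ler_wpM2r; [exact: G_ge0|exact: le_D].
- by rewrite mulrA; apply: ler_wpM2r; [exact: G_ge0|exact: D_le_scale].
Qed.
End Bodies.
End Comparison.

Theorem corollary1 (R : realType) (d : nat) (K K0 : set 'rV[R]_d) (beta : R)
    (hK_nonempty : K !=set0) (hK0_nonempty : K0 !=set0)
    (hK_bounded : bounded_set K) (hK0_bounded : bounded_set K0)
    (hK_convex : convex_set K) (hK0_convex : convex_set K0)
    (hK0_neq0 : K0 <> [set 0])
    (hbeta : 1 <= beta)
    (hK0K : K0 `<=` K)
    (hKK0 : K `<=` [set beta *: x | x in K0])
    (hsym : K0 = [set - x | x in K0])
    (s : nat) (hs : (1 <= s <= d)%N)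
    (x1 : 'rV[R]_d) (hx1 : K0 x1) :
  beta^-1 * gain x1 K0 s <= gain x1 K s.
Proof.
apply: le_gain => //.
- by move=> x K0x; rewrite hsym; exists x.
- apply: contrapT => K00; apply: hK0_neq0; apply/seteqP.
  have zero x : K0 x -> x = 0.
    by move=> K0x; apply/eqP; apply: contrapT => /negP x0; apply: K00; exists x.
  by split => [x /zero//|_ ->]; rewrite -(zero _ hx1).
Qed.
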